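(* Let $0<\sigma<1$ and $F_{n,\sigma}=\sum_{\kappa/\lambda\in\mathcal F_n}\frac{\cos(2\pi\kappa/\lambda)}{(\kappa\lambda)^\sigma}$. Then $$F_{n,\sigma}=\frac{n^{2(1-\sigma)}}{2(1-\sigma)\zeta(2)}\int_0^1\frac{\cos2\pi t}{t^\sigma}dt+O_\sigma\big(n^{1-\sigma}\big).$$
   Context: $\mathcal F_n=\{j/m: 1\le j\le m\le n,\ \gcd(j,m)=1\}$ is the Farey series of order $n$ (fractions in lowest terms, including $1/1$). $\zeta$ is the Riemann zeta function. *)

(* Defs.v *)
From HB Require Import structures.
From mathcomp Require Import all_boot all_order all_algebra.
From mathcomp Require Import all_classical all_reals all_analysis.
Set Implicit Arguments. Unset Strict Implicit. Unset Printing Implicit Defensive.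
Import Order.TTheory GRing.Theory Num.Theory.
Import numFieldNormedType.Exports.
Local Open Scope ring_scope.

Definition zeta2 (R : realType) : R :=
  limn (series (fun k : nat => ((k.+1)%:R ^+ 2)^-1 : R)).

Definition Farey_cos_sum (R : realType) (n : nat) (sigma : R) : R :=
  \sum_(1 <= l < n.+1) \sum_(1 <= k < l.+1 | coprime k l)
     cos (2 * pi * (k%:R / l%:R)) / ((k * l)%:R `^ sigma).

Definition cos_integral (R : realType) (sigma : R) : R :=
  Rintegral (@lebesgue_measure R) `[0, 1]%classic
    (fun t : R => cos (2 * pi * t) / (t `^ sigma)).

(* Main.v *)
Require Import Defs.
From HB Require Import structures.
From mathcomp Require Import all_boot all_order all_algebra.
From mathcomp Require Import all_classical all_reals all_analysis.
From mathcomp Require Import measurable_realfun zify ring lra.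
Set Implicit Arguments.
Unset Strict Implicit.
Unset Printing Implicit Defensive.
Import Order.TTheory GRing.Theory Num.Theory.
Import numFieldNormedType.Exports.
Local Open Scope ring_scope.

(* With f(t) = cos(2 pi t) t^(-s), a common factor d of numerator and
   denominator contributes d^(-2s), so Moebius inversion gives
   F_n = sum_(d <= n) mu(d) d^(-2s) A(n/d), where
   A(m) = sum_(q <= m) q^(-2s) sum_(j <= q) f(j/q).
   Comparing each cell of length 1/q with the integral yields
   sum_(j <= q) f(j/q) = q I + O(q^s), whence A(m) = c m^(2-2s) + O(m^(1-s))
   with c = I / (2-2s).  Substituting, the errors add up to
   O(n^(1-s) sum_d d^(-1-s)) = O(n^(1-s)), and the main term is
   c n^(2-2s) sum_(d <= n) mu(d)/d^2.  The identity
   1 = sum_(d <= n) mu(d) d^(-2) sum_(q <= n/d) q^(-2)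
   shows that this last sum is 1/zeta(2) + O(n^(s-1)). *)

(** * The Moebius function and removal of coprimality conditions *)

Definition moebius (R : pzRingType) (n : nat) : R :=
  if all (fun p => logn p n == 1%N) (primes n) then (-1) ^+ size (primes n) else 0.

Lemma norm_moebius_le1 (R : numDomainType) n : `|moebius R n| <= 1.
Proof.
by rewrite /moebius; case: ifP => _; rewrite ?normr0 ?ler01// normrX normrN1 expr1n.
Qed.

Lemma moebius_square_dvdn (R : pzRingType) p n :
  prime p -> (0 < n)%N -> (p ^ 2 %| n)%N -> moebius R n = 0.
Proof.
move=> pp n0 p2n; rewrite /moebius ifF//; apply/negbTE/allPn; exists p.
  by rewrite mem_primes pp n0 (dvdn_trans _ p2n)// expnS dvdn_mulr.
by rewrite pfactor_dvdn// in p2n; rewrite gtn_eqF.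
Qed.

Lemma moebius_prime_mul (R : pzRingType) p n :
  prime p -> (0 < n)%N -> ~~ (p %| n)%N -> moebius R (p * n) = - moebius R n.
Proof.
move=> pp n0 pn; have p0 := prime_gt0 pp.
have pnP : p \notin primes n by rewrite mem_primes (negbTE pn) !andbF.
have primes_pn : perm_eq (primes (p * n)) (p :: primes n).
  rewrite uniq_perm ?primes_uniq//= ?pnP ?primes_uniq// => q.
  by rewrite primesM// primes_prime// !inE.
rewrite /moebius (perm_all _ primes_pn) (perm_size primes_pn)/=.
have -> : (logn p (p * n) == 1)%N.
  by rewrite lognM// lognE pp p0 dvdnn/= divnn p0 logn1 lognE (negbTE pn) !andbF.
have -> : all (fun q => logn q (p * n) == 1)%N (primes n)
        = all (fun q => logn q n == 1)%N (primes n).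
  apply: eq_in_all => q qn; rewrite lognM// lognE.
  have [qp|] := boolP (q %| p)%N; last by rewrite !andbF.
  suff qEp : q = p by rewrite -qEp qn in pnP.
  apply/eqP; move: qn qp; rewrite mem_primes => /andP[pq _].
  by rewrite dvdn_prime2.
by rewrite andTb; case: ifP => _; rewrite ?oppr0 ?exprS ?mulN1r.
Qed.

Lemma sum_multiples (V : nmodType) (h : nat -> V) d n : (0 < d)%N ->
  \sum_(1 <= l < n.+1 | (d %| l)%N) h l
  = \sum_(1 <= q < (n %/ d).+1) h (d * q)%N.
Proof.
move=> d0; elim: n => [|n IHn]; first by rewrite div0n !big_geq.
rewrite big_mkcond big_nat_recr//= -big_mkcond IHn divnS//.
have [dn|_] := boolP (d %| n.+1)%N; last by rewrite addr0.
rewrite add1n [RHS]big_nat_recr//=; congr (_ + h _).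
by move: (divnK dn); rewrite divnS// dn mulnC add1n => ->.
Qed.

Lemma sum_nat_widen_pred (V : nmodType) (P : pred nat) (h : nat -> V) m n :
  (m <= n)%N -> (forall l, (m < l)%N -> P l = false) ->
  \sum_(1 <= l < n.+1 | P l) h l = \sum_(1 <= l < m.+1 | P l) h l.
Proof.
move=> mn Pm; rewrite (@big_cat_nat _ _ _ m.+1)//=.
rewrite [X in _ + X]big_nat_cond [X in _ + X]big1 ?addr0// => l /andP[/andP[ml _]].
by rewrite Pm.
Qed.

(* For a prime [p] dividing [m], the terms [d] and [p * d] with [p] not
   dividing [d] cancel, and the terms with [p ^ 2 %| d] vanish. *)
Lemma sum_moebius_divisors (R : pzRingType) m n : (0 < m <= n)%N ->
  \sum_(1 <= d < n.+1 | (d %| m)%N) moebius R d = (m == 1%N)%:R.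
Proof.
case/andP=> m0 mn; rewrite (@sum_nat_widen_pred _ _ _ m)//; last first.
  by move=> d md; apply/negbTE/negP => /(dvdn_leq m0); rewrite leqNgt md.
have [->|m1] := eqVneq m 1%N.
  by rewrite big_mkcond big_nat1 dvdnn /moebius.
have pp : prime (pdiv m) by rewrite pdiv_prime// ltn_neqAle eq_sym m1.
have pm := pdiv_dvd m; set p := pdiv m in pp pm; have p0 := prime_gt0 pp.
rewrite (bigID (fun d => p %| d)%N)/=.
rewrite (eq_bigl (fun d => (p %| d) && (d %| m))%N); last by move=> d; rewrite andbC.
rewrite big_mkcondr/= sum_multiples// -big_mkcond/=.
rewrite (bigID (fun d => p %| d)%N)/= big_nat_cond big1 ?add0r; last first.
  move=> d /andP[/andP[d0 _] /andP[_ pd]].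
  by rewrite (@moebius_square_dvdn _ p)// ?muln_gt0 ?p0// expnS expn1 dvdn_pmul2l.
(* A divisor [d] of [m] not divisible by [p] satisfies [d * p <= m], so this sum can be cut to the
   range of the sum over multiples of [p]. *)
rewrite [X in _ + X](@sum_nat_widen_pred _ _ _ (m %/ p)) ?leq_div//; last first.
  move=> d md; apply/negbTE/negP => /andP[dm pd].
  have : (d * p <= m)%N by rewrite dvdn_leq// Gauss_dvd ?dm// coprime_sym prime_coprime.
  by rewrite -leq_divRL// leqNgt md.
rewrite big_nat_cond [X in _ + X]big_nat_cond.
rewrite (eq_bigr (fun d => - moebius R d)); last first.
  by move=> d /andP[/andP[d0 _] /andP[_ pd]]; rewrite moebius_prime_mul.
rewrite sumrN [X in - X](eq_bigl (fun d => (1 <= d < (m %/ p).+1)%N && ((d %| m) && ~~ (p %| d))%N)) ?addNr//.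
move=> d; congr (_ && _); have [_|pd] := boolP (p %| d)%N; rewrite ?andbF// !andbT.
by rewrite Gauss_dvd ?pm// prime_coprime.
Qed.

(** After exchanging the sums, [h l] has as coefficient the sum of [moebius R d] over [d] dividing
    [l], which vanishes unless [l = 1]. *)
Lemma sum_moebius_multiples (R : pzRingType) (h : nat -> R) n : (0 < n)%N ->
  \sum_(1 <= d < n.+1) moebius R d * \sum_(1 <= q < (n %/ d).+1) h (d * q)%N
  = h 1%N.
Proof.
move=> n0; transitivity
  (\sum_(1 <= d < n.+1) \sum_(1 <= l < n.+1 | (d %| l)%N) moebius R d * h l).
  apply: eq_big_nat => d /andP[d0 _].
  by rewrite -big_distrr/= (@sum_multiples _ h).
rewrite (exchange_big_dep xpredT)//=.
rewrite (eq_big_nat _ _ (F2 := fun l => (l == 1%N)%:R * h l)); last first.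
  by move=> l /andP[l0 ln]; rewrite -big_distrl/= sum_moebius_divisors ?l0.
rewrite big_nat_recl// eqxx mul1r big_nat_cond big1 ?addr0// => l /andP[/andP[l0 _] _].
by rewrite eqSS (gtn_eqF l0) mul0r.
Qed.

(** The indicator of coprimality is the sum of [moebius R d] over the divisors [d] of [gcdn k l].
    Moving the sum over [d] outside and putting [k = d * j], [l = d * q] gives the right-hand
    side. *)
Lemma sum_coprime_pairs (R : comPzRingType) (g : nat -> nat -> R) n :
  \sum_(1 <= l < n.+1) \sum_(1 <= k < l.+1 | coprime k l) g k l
  = \sum_(1 <= d < n.+1) moebius R d *
      \sum_(1 <= q < (n %/ d).+1) \sum_(1 <= j < q.+1) g (d * j)%N (d * q)%N.
Proof.
transitivity (\sum_(1 <= l < n.+1) \sum_(1 <= k < l.+1)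
    \sum_(1 <= d < n.+1 | (d %| l)%N) (if (d %| k)%N then moebius R d * g k l else 0)).
  apply: eq_big_nat => l /andP[l0 ln]; rewrite big_mkcond/=.
  apply: eq_big_nat => k /andP[k0 kl].
  rewrite -big_mkcondr (eq_bigl (fun d => d %| gcdn k l)%N)/=; last first.
    by move=> d; rewrite dvdn_gcd andbC.
  have gn : (0 < gcdn k l <= n)%N.
    rewrite gcdn_gt0 k0/=; move: ln; rewrite ltnS; apply: leq_trans.
    by apply: dvdn_leq => //; exact: dvdn_gcdr.
  rewrite -big_distrl/= sum_moebius_divisors//.
  by rewrite /coprime; case: eqP => _; rewrite ?mul1r ?mul0r.
transitivity (\sum_(1 <= d < n.+1) \sum_(1 <= l < n.+1 | (d %| l)%N)
    \sum_(1 <= k < l.+1 | (d %| k)%N) moebius R d * g k l).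
  rewrite [RHS](exchange_big_dep xpredT)//=; apply: eq_big_nat => l _.
  rewrite exchange_big/=; apply: eq_bigr => d _; by rewrite -big_mkcond.
apply: eq_big_nat => d /andP[d0 _].
rewrite big_distrr/= sum_multiples//; apply: eq_bigr => q _.
by rewrite sum_multiples// mulKn// big_distrr.
Qed.

(** * Sums of real powers compared with integrals *)

Section powR_sums.
Variable R : realType.
Implicit Types (a b p r s : R).

(** Stands in for integration below: it compares a term k^(p-1) with an increment of x^p / p. *)
Lemma powR_MVT p a b : 0 < a -> a < b ->
  exists2 c, a < c < b & b `^ p - a `^ p = p * c `^ (p - 1) * (b - a).
Proof.
move=> a0 ab.
have dp (x : R) : 0 < x -> is_derive x 1 (@powR R ^~ p) (p * x `^ (p - 1)).
  by move=> x0; exact: is_derive1_powR.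
have [x|x|c] := @MVT R (@powR R ^~ p) (fun x => p * x `^ (p - 1)) a b ab.
- by rewrite in_itv/= => /andP[ax _]; apply: dp; exact: lt_trans ax.
- move: x; apply: derivable_within_continuous => x.
  rewrite in_itv/= => /andP[ax _].
  by have [] := dp x (lt_le_trans a0 ax).
- by rewrite in_itv/= => acb E; exists c.
Qed.

Lemma ler_powR_nonpos r a b : r <= 0 -> 0 < a -> a <= b -> b `^ r <= a `^ r.
Proof.
move=> r0 a0 ab; have b0 := lt_le_trans a0 ab.
rewrite -[r]opprK [leLHS]powRN [leRHS]powRN lef_pV2 ?posrE ?powR_gt0//.
by rewrite ge0_ler_powR ?oppr_ge0// nnegrE ltW.
Qed.

Lemma sum_powRN_le s n : 0 < s < 1 ->
  \sum_(1 <= q < n.+1) q%:R `^ (- s) <= n%:R `^ (1 - s) / (1 - s) :> R.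
Proof.
case/andP=> s0 s1; have s'0 : 0 < 1 - s by rewrite subr_gt0.
elim: n => [|n IHn]; first by rewrite big_geq// divr_ge0 ?powR_ge0// ltW.
rewrite big_nat_recr//=; apply: le_trans (lerD IHn (lexx _)) _.
rewrite addrC -lerBrDr -mulrBl ler_pdivlMr//.
(* The mean value argument needs a positive left end, so the cell from 0 to 1 is treated apart, with
   0^(1-s) = 0. *)
have [->|n0] := posnP n.
  by rewrite powR0 ?gt_eqF// !powR1 subr0 mul1r; lra.
have [||c /andP[nc cn] ->] := @powR_MVT (1 - s) n%:R n.+1%:R; rewrite ?ltr0n ?ltr_nat//.
rewrite -natrB// subSnn mulr1 mulrC ler_pM2l//.
rewrite (_ : 1 - s - 1 = - s); last by ring.
rewrite ler_powR_nonpos ?oppr_le0 ?(ltW s0) ?(ltW cn)//.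
by apply: lt_trans nc; rewrite ltr0n.
Qed.

Lemma sum_powRN1_le s n : 0 < s ->
  \sum_(1 <= d < n.+1) d%:R `^ (- (1 + s)) <= 1 + s^-1 :> R.
Proof.
move=> s0; have [->|n0] := posnP n.
  by rewrite big_geq// addr_ge0// invr_ge0 ltW.
(* Keeping the negative term makes the bound inductive: each new summand is at most an increment of
   - x^(-s) / s. *)
suff : \sum_(1 <= d < n.+1) d%:R `^ (- (1 + s)) <= 1 + (1 - n%:R `^ (- s)) / s.
  move=> /le_trans; apply; rewrite lerD2l -[leRHS]mul1r ler_pM2r ?invr_gt0//.
elim: n n0 => // -[_ _|n /(_ isT) IHn _].
  by rewrite big_nat1 !powR1 subrr mul0r addr0.
rewrite big_nat_recr//=; apply: le_trans (lerD IHn (lexx _)) _.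
rewrite -addrA lerD2l addrC -lerBrDr -mulrBl ler_pdivlMr//.
have [||c /andP[nc cn] E] := @powR_MVT (- s) n.+1%:R n.+2%:R; rewrite ?ltr0n ?ltr_nat//.
have -> : 1 - n.+2%:R `^ (- s) - (1 - n.+1%:R `^ (- s)) =
  - (n.+2%:R `^ (- s) - n.+1%:R `^ (- s)) :> R by ring.
rewrite E -natrB// subSnn mulr1 mulNr opprK mulrC ler_pM2l//.
rewrite (_ : - s - 1 = - (1 + s)); last by ring.
rewrite ler_powR_nonpos ?(ltW cn)//; first lra.
by apply: lt_trans nc; rewrite ltr0n.
Qed.

(** The map x^r is monotone for either sign of [r], so its variation is additive. This treats both
    signs of the exponent [p - 1] at once in the next estimate. *)
Lemma powR_dist_add r a b c : 0 < a -> a <= b -> b <= c ->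
  `|c `^ r - a `^ r| = `|c `^ r - b `^ r| + `|b `^ r - a `^ r|.
Proof.
move=> a0 ab bc; have b0 := lt_le_trans a0 ab.
have [r0|r0] := leP 0 r.
  have h1 : a `^ r <= b `^ r by rewrite ge0_ler_powR ?nnegrE ?(ltW a0) ?(ltW b0).
  have h2 : b `^ r <= c `^ r.
    by rewrite ge0_ler_powR ?nnegrE ?(ltW b0) ?(le_trans (ltW b0) bc).
  have h3 := le_trans h1 h2.
  by rewrite !ger0_norm ?subr_ge0//; ring.
have h1 : b `^ r <= a `^ r by rewrite ler_powR_nonpos// ltW.
have h2 : c `^ r <= b `^ r by rewrite ler_powR_nonpos// ltW.
have h3 := le_trans h2 h1.
by rewrite !ler0_norm ?subr_le0//; ring.
Qed.

Lemma powR_dist1_le r t a : 1 <= a -> 0 <= t -> r <= t -> `|a `^ r - 1| <= a `^ t.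
Proof.
move=> a1 t0 rt; have at1 : 1 <= a `^ t by rewrite -(powRr0 a) ler_powR.
have art : a `^ r <= a `^ t by rewrite ler_powR.
by rewrite ler_norml; have := powR_ge0 a r; lra.
Qed.

(** Each term differs from the increment of x^p / p over the cell on its left by at most the
    variation of x^(p-1) there, and these variations add up to |n^(p-1) - 1|. The exponent [t]
    absorbs both this and the constants. *)
Lemma sum_powR_asymp p t n : 0 < p -> 0 <= t -> p - 1 <= t -> (0 < n)%N ->
  `|\sum_(1 <= q < n.+1) q%:R `^ (p - 1) - n%:R `^ p / p|
    <= (2 + p^-1) * n%:R `^ t.
Proof.
move=> p0 t0 pt n0; have pV0 : 0 < p^-1 by rewrite invr_gt0.
suff : `|\sum_(1 <= q < n.+1) q%:R `^ (p - 1) - n%:R `^ p / p|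
    <= 1 + p^-1 + `|n%:R `^ (p - 1) - 1|.
  have n1 : 1 <= n%:R :> R by rewrite ler1n.
  have h1 : 1 <= n%:R `^ t :> R by rewrite -[leLHS](powRr0 n%:R) ler_powR.
  have := powR_dist1_le n1 t0 pt; move=> h2 /le_trans; apply; nra.
elim: n n0 => // -[_ _|n /(_ isT) IHn _].
  rewrite big_nat1 !powR1 subrr normr0 addr0 mul1r.
  by rewrite ler_norml; apply/andP; split; lra.
rewrite big_nat_recr//=.
have [||c /andP[nc cn] E] := @powR_MVT p n.+1%:R n.+2%:R; rewrite ?ltr0n ?ltr_nat//.
move: E; rewrite -natrB// subSnn mulr1 => E.
have {}E : n.+2%:R `^ p / p = n.+1%:R `^ p / p + c `^ (p - 1).
  by rewrite -(subrK (n.+1%:R `^ p) (n.+2%:R `^ p)) E mulrDl addrC [p * _]mulrC mulfK ?gt_eqF.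
have n10 : 0 < n.+1%:R :> R by rewrite ltr0n.
have h := powR_dist_add (p - 1) n10 (ltW nc) (ltW cn).
have h0 := normr_ge0 (c `^ (p - 1) - n.+1%:R `^ (p - 1)).
have n11 : 1 <= n.+1%:R :> R by rewrite ler1n.
have n12 : n.+1%:R <= n.+2%:R :> R by rewrite ler_nat.
have := powR_dist_add (p - 1) ltr01 n11 n12.
rewrite !powR1 => ->; rewrite E.
set S := (\sum_(1 <= q < n.+2) _) in IHn *.
(* The increment of x^p / p over the new cell is c^(p-1), so the new error is only a part of the
   variation on that cell. *)
rewrite (_ : _ - _ = (n.+2%:R `^ (p - 1) - c `^ (p - 1)) + (S - n.+1%:R `^ p / p)); last by ring.
apply: le_trans (ler_normD _ _) _; lra.
Qed.

(** Mean value theorem on an interval of length below 1: the cost of replacing the integer part of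
    n/d by n/d in the main term. *)
Lemma powR_divn_dist p t n d : 0 < p -> 0 <= t -> p - 1 <= t -> (0 < d <= n)%N ->
  `|(n %/ d)%:R `^ p - (n%:R / d%:R) `^ p| <= p * (n%:R / d%:R) `^ t.
Proof.
move=> p0 t0 pt /andP[d0 dn].
have d0' : 0 < d%:R :> R by rewrite ltr0n.
have m0 : (0 < n %/ d)%N by rewrite divn_gt0.
have m1 : 1 <= (n %/ d)%:R :> R by rewrite ler1n.
have y_ge : (n %/ d)%:R <= n%:R / d%:R :> R.
  by rewrite ler_pdivlMr// -natrM ler_nat leq_divM.
have y_lt : n%:R / d%:R < (n %/ d)%:R + 1 :> R.
  by rewrite ltr_pdivrMr// natr1 -natrM ltr_nat ltn_ceil.
set m := (n %/ d)%:R in m1 y_ge y_lt *; set y := n%:R / d%:R in y_ge y_lt *.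
rewrite distrC; move: y_ge; rewrite le_eqVlt => /predU1P[->|my].
  by rewrite subrr normr0 mulr_ge0 ?powR_ge0// ltW.
have [||c /andP[mc cy] ->] := @powR_MVT p m y; [lra|by []|].
(* Since [d <= n], the integer part is at least 1; hence [c >= 1] and the exponent [p - 1] may be
   raised to [t]. *)
have c1 : 1 <= c by lra.
rewrite !normrM (gtr0_norm p0) ger0_norm ?powR_ge0// gtr0_norm ?subr_gt0//.
rewrite -mulrA ler_pM2l//.
apply: (@le_trans _ _ (c `^ (p - 1))).
  by rewrite ler_piMr ?powR_ge0//; lra.
apply: (@le_trans _ _ (c `^ t)); first exact: ler_powR.
by rewrite ge0_ler_powR// ?nnegrE; lra.
Qed.

End powR_sums.

(** * The integrand cos(2 pi t) t^(-s) and its integrability at 0 *)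

Section cos_powR_integral.
Local Open Scope classical_set_scope.
Local Open Scope ring_scope.
Variables (R : realType).
Notation mu := (@lebesgue_measure R).
Implicit Types (a b s : R).

Lemma continuous_within_powR r a b : 0 < a ->
  {within `[a, b], continuous (@powR R ^~ r)}.
Proof.
move=> a0; apply: derivable_within_continuous => x.
rewrite in_itv/= => /andP[ax _].
by have [] := @is_derive1_powR R r x (lt_le_trans a0 ax).
Qed.

Lemma integral_powRN_pos s a b : s < 1 -> 0 < a -> a < b ->
  (\int[mu]_(t in `[a, b]) (t `^ (- s))%:E
   = ((1 - s)^-1 * b `^ (1 - s) - (1 - s)^-1 * a `^ (1 - s))%:E)%E.
Proof.
move=> s1 a0 ab; have s'0 : 1 - s != 0 by rewrite subr_eq0 gt_eqF.
pose F (t : R) := (1 - s)^-1 * t `^ (1 - s).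
have dF (t : R) : 0 < t -> is_derive t 1 F (t `^ (- s)).
  move=> t0; rewrite (_ : t `^ (- s) = (1 - s)^-1 *: ((1 - s) * t `^ (1 - s - 1))).
    by apply: is_deriveZ; exact: is_derive1_powR.
  by rewrite /GRing.scale/= mulKf// addrAC subrr add0r.
have cF (t : R) : 0 < t -> {for t, continuous F}.
  by move=> /dF[dFt _]; apply/differentiable_continuous/derivable1_diffP.
rewrite (@continuous_FTC2 _ _ F)//.
- exact: continuous_within_powR.
- split.
  + by move=> t; rewrite in_itv/= => /andP[at_ _]; have [] := dF t (lt_trans a0 at_).
  + by apply: cvg_at_right_filter; exact: cF.
  + by apply: cvg_at_left_filter; apply: cF; exact: lt_trans ab.
- move=> t; rewrite in_itv/= => /andP[at_ _].
  by rewrite derive1E; have [_ ->] := dF t (lt_trans a0 at_).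
Qed.

Lemma measurable_powRN s (D : set R) : measurable_fun D (fun t : R => (t `^ (- s))%:E).
Proof.
apply/measurable_EFinP; apply: measurable_funTS; exact: measurable_powR.
Qed.

(** The singularity at 0 is reached by monotone convergence from intervals on which the
    antiderivative t^(1-s) / (1-s) is available. *)
Lemma integral_powRN_le s a : 0 < s < 1 -> 0 < a ->
  (\int[mu]_(t in `]0%R, a]) (t `^ (- s))%:E <= ((1 - s)^-1 * a `^ (1 - s))%:E)%E.
Proof.
case/andP=> s0 s1 a0; have s'0 : 0 < 1 - s by rewrite subr_gt0.
(* The shift by 2 makes the left end smaller than [a] already for [k = 0]. *)
pose F k := `[a / k.+2%:R, a]%classic.
have bigF : `]0%R, a]%classic = \bigcup_k F k.
  apply/seteqP; split => [t|t [k _]]; rewrite /F/= !in_itv/=.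
    move=> /andP[t0 ta]; exists (Num.truncn (a / t)) => //=.
    rewrite in_itv/= ta andbT ler_pdivrMr// mulrC -ler_pdivrMr//.
    by apply: ltW; apply: lt_trans (truncnS_gt _) _; rewrite ltr_nat.
  move=> /andP[kt ->]; rewrite andbT; apply: lt_le_trans kt.
  by rewrite divr_gt0.
rewrite bigF.
have cvgF : (\int[mu]_(t in F k) (t `^ (- s))%:E @[k --> \oo]
   --> \int[mu]_(t in \bigcup_k F k) (t `^ (- s))%:E)%E.
  apply: ge0_nondecreasing_set_cvg_integral => //.
  - apply/nondecreasing_seqP => n; rewrite subsetEset; apply: subset_itvr.
    by rewrite bnd_simp ler_pM2l// lef_pV2 ?posrE// ler_nat.
  - by move=> i; exact: measurable_itv.
  - by move=> i; exact: measurable_powRN.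
  - by move=> i x _; rewrite lee_fin powR_ge0.
move/cvg_lim : (cvgF) => <-//; apply: lime_le; first by apply/cvg_ex; eexists; exact: cvgF.
apply: nearW => k; rewrite /F integral_powRN_pos//.
- by rewrite lee_fin lerBlDr lerDl mulr_ge0 ?powR_ge0// invr_ge0 ltW.
- by rewrite divr_gt0.
- by rewrite ltr_pdivrMr// ltr_pMr// ltr1n.
Qed.

Lemma cos_Lipschitz (x y : R) : `|cos x - cos y| <= `|x - y|.
Proof.
wlog xy : x y / x < y.
  move=> H; have [xy|xy|->] := ltgtP x y; last by rewrite !subrr.
    exact: H.
  by rewrite distrC [leRHS]distrC; exact: H.
have [|c _] := @MVT R cos (fun x => - sin x) x y xy.
- by apply: derivable_within_continuous => z _; exact: derivable_cos.
rewrite distrC => ->; rewrite normrM normrN [`|y - x|]distrC.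
by rewrite ler_piMl// sin_max.
Qed.

Definition cos_powR s (t : R) : R := cos (2 * pi * t) * t `^ (- s).

Lemma norm_cos_powR_le s t : `|cos_powR s t| <= t `^ (- s).
Proof.
rewrite normrM [X in _ * X]ger0_norm ?powR_ge0//.
by rewrite ler_piMl ?powR_ge0// cos_max.
Qed.

Lemma measurable_cos_powR s (D : set R) : measurable_fun D (cos_powR s).
Proof.
apply: measurable_funM; last by apply: measurable_funTS; exact: measurable_powR.
apply: measurable_funTS; apply: measurableT_comp.
  by apply: continuous_measurable_fun; exact: continuous_cos.
exact: measurable_funM.
Qed.

(** Domination by t^(-s), whose integral is finite once the null set {0} is dropped. *)
Lemma integrable_cos_powR s : 0 < s < 1 -> mu.-integrable `[0, 1] (EFin \o cos_powR s).
Proof.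
move=> s01; apply: (@le_integrable _ _ _ mu _ _ _ (fun t => (t `^ (- s))%:E)) => //.
- by apply/measurable_EFinP; exact: measurable_cos_powR.
- move=> t _; rewrite lee_fin [leRHS]ger0_norm ?powR_ge0//.
  exact: norm_cos_powR_le.
apply/integrableP; split; first exact: measurable_powRN.
under eq_integral do rewrite gee0_abs ?lee_fin ?powR_ge0//.
rewrite -integral_itv_obnd_cbnd; last exact: measurable_powRN.
by rewrite (le_lt_trans (integral_powRN_le s01 ltr01))// ltry.
Qed.

(** Error of the rectangle rule on one cell; below, [c] is the value of the integrand at the right
    endpoint. *)
Lemma Rintegral_near_cst (f : R -> R) a b c e : a < b ->
  mu.-integrable `]a, b] (EFin \o f) ->
  (forall t, a < t <= b -> `|f t - c| <= e) ->
  `|Rintegral mu `]a, b] f - c * (b - a)| <= e * (b - a).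
Proof.
move=> ab intf fce.
have muab : fine (mu `]a, b]) = b - a.
  by rewrite lebesgue_measure_itv/= lte_fin ab.
have intc r : mu.-integrable `]a, b] (EFin \o (fun=> r)).
  apply: (@integrableS _ _ _ mu `[a, b]) => //; first exact: subset_itv_oc_cc.
  apply: continuous_compact_integrable; first exact: segment_compact.
  by apply: continuous_subspaceT => x; exact: cst_continuous.
have intfc : mu.-integrable `]a, b] (EFin \o (fun t => f t - c)).
  exact: (@integrableB _ _ _ mu _ _ (EFin \o f) (EFin \o (fun=> c))).
rewrite -muab -!Rintegral_cst//= -RintegralB//.
apply: (le_trans (le_normr_Rintegral _ intfc)) => //.
apply: le_Rintegral => //=.
exact: integrable_norm.
Qed.
End cos_powR_integral.

(** * Riemann sums of the singular integrand *)

Section Riemann_sum.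
Local Open Scope classical_set_scope.
Local Open Scope ring_scope.
Variables (R : realType) (s : R).
Hypothesis s01 : 0 < s < 1.
Notation mu := (@lebesgue_measure R).
Let f := cos_powR s.

Let integrable_sub a b : 0 <= a -> b <= 1 -> mu.-integrable `]a, b] (EFin \o f).
Proof.
move=> a0 b1; apply: (integrableS _ _ _ (integrable_cos_powR s01)) => //.
by move=> t; rewrite /= !in_itv/= => /andP[at_ tb]; apply/andP; split; lra.
Qed.

(** Serves for the cell touching 0, where the rectangle rule gives no useful bound. *)
Lemma norm_Rintegral_cos_powR_le a : 0 < a <= 1 ->
  `|Rintegral mu `]0, a] f| <= (1 - s)^-1 * a `^ (1 - s).
Proof.
case/andP=> a0 a1; have intf := integrable_sub (lexx 0) a1.
apply: le_trans (le_normr_Rintegral _ intf) _ => //.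
rewrite -lee_fin /Rintegral fineK; last first.
  by apply: integrable_fin_num => //; exact: integrable_norm.
apply: le_trans (integral_powRN_le s01 a0).
apply: ge0_le_integral => //.
- by apply/measurable_EFinP; apply: measurableT_comp => //; exact: measurable_cos_powR.
- exact: measurable_powRN.
- by move=> t _; rewrite lee_fin norm_cos_powR_le.
Qed.

(** The cosine contributes through its Lipschitz bound and the power through monotonicity. The
    latter contribution is left as a difference so that it telescopes over consecutive cells. *)
Lemma cos_powR_dist x t y : 0 < x -> x < t -> t <= y ->
  `|f t - f y| <= 2 * pi * (y - x) * x `^ (- s) + (x `^ (- s) - y `^ (- s)).
Proof.
move=> x0 xt ty; have s0 : - s <= 0 by rewrite oppr_le0 ltW//; case/andP: s01.
have t0 := lt_trans x0 xt.
have hx : t `^ (- s) <= x `^ (- s) by rewrite ler_powR_nonpos// ltW.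
have hy : y `^ (- s) <= t `^ (- s) by rewrite ler_powR_nonpos.
rewrite /f /cos_powR.
have -> : cos (2 * pi * t) * t `^ (- s) - cos (2 * pi * y) * y `^ (- s)
  = (cos (2 * pi * t) - cos (2 * pi * y)) * t `^ (- s)
    + cos (2 * pi * y) * (t `^ (- s) - y `^ (- s)) by ring.
apply: le_trans (ler_normD _ _) _; rewrite !normrM; apply: lerD.
  rewrite [X in _ * X]ger0_norm ?powR_ge0//.
  apply: ler_pM; rewrite ?powR_ge0//.
  apply: le_trans (cos_Lipschitz _ _) _.
  have pi0 := pi_ge0 R.
  rewrite -mulrBr normrM [`|t - y|]distrC !ger0_norm; [|lra|lra].
  by rewrite ler_pM2l ?mulr_gt0 ?pi_gt0// lerB// ltW.
rewrite -[leRHS]mul1r ler_pM ?cos_max//.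
by rewrite ger0_norm ?subr_ge0// lerD2r.
Qed.

Lemma cos_powR_Riemann_sum q : (0 < q)%N ->
  `|\sum_(1 <= j < q.+1) f (j%:R / q%:R) - q%:R * Rintegral mu `[0, 1] f|
    <= (2 + 2 * pi + (1 - s)^-1) * q%:R `^ s.
Proof.
move=> q0; have /andP[s0 s1] := s01; have s'0 : 0 < 1 - s by rewrite subr_gt0.
have q0' : 0 < q%:R :> R by rewrite ltr0n.
have pi0 : 0 < pi :> R by exact: pi_gt0.
pose x j : R := j%:R / q%:R.
have xS j : x j.+1 - x j = q%:R^-1 by rewrite -mulrBl -natrB// subSnn mul1r.
have x_ge0 j : 0 <= x j by rewrite divr_ge0.
have x_le1 j : (j <= q)%N -> x j <= 1 by rewrite ler_pdivrMr// mul1r ler_nat.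
have x_lt j : x j < x j.+1 by rewrite -subr_gt0 xS invr_gt0.
have xN1 : x 1%N `^ (- s) = q%:R `^ s.
  by rewrite /x mul1r -powR_inv1// -powRrM mulrNN mul1r.
pose G y := Rintegral mu `[0, y] f.
have GE j : (j < q)%N -> G (x j.+1) - G (x j) = Rintegral mu `]x j, x j.+1] f.
  move=> jq; apply: Rintegral_itvB; rewrite ?bnd_simp ?x_ge0 ?(ltW (x_lt j))//.
  apply: (integrableS _ _ _ (integrable_cos_powR s01)) => //.
  by apply: subset_itvl; rewrite bnd_simp; exact: x_le1.
have G0 : G (x 0%N) = 0 by rewrite /x mul0r /G set_itv1 Rintegral_set1.
have Gq : G (x q) = Rintegral mu `[0, 1] f by rewrite /x divff ?gt_eqF.
(* Error of the cell from [x j] to [x j.+1], scaled by [q]; the integrals telescope in the sum over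
   [j]. *)
pose T j := f (x j.+1) - q%:R * (G (x j.+1) - G (x j)).
rewrite (_ : _ - _ = \sum_(0 <= j < q) T j); last first.
  by rewrite big_add1 sumrB -mulr_sumr telescope_sumr// Gq G0 subr0.
(* On the first cell the two terms are bounded separately, by (1/q)^(-s) = q^s and by q (1/q)^(1-s)
   / (1-s). *)
have T0 : `|T 0%N| <= (1 + (1 - s)^-1) * q%:R `^ s.
  apply: le_trans (ler_normB _ _) _; rewrite mulrDl mul1r; apply: lerD.
    by apply: le_trans (norm_cos_powR_le _ _) _; rewrite xN1.
  rewrite GE// normrM gtr0_norm// {1}/x mul0r.
  have h : 0 < x 1%N <= 1 by rewrite x_le1// divr_gt0.
  apply: (@le_trans _ _ (q%:R * ((1 - s)^-1 * x 1%N `^ (1 - s)))).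
    by rewrite ler_pM2l// norm_Rintegral_cos_powR_le.
  rewrite powRD; last by rewrite gt_eqF ?implybT// divr_gt0.
  by rewrite powRr1// xN1 /x mul1r mulrCA mulVKf ?gt_eqF.
have TS j : (0 < j < q)%N ->
    `|T j| <= 2 * pi * q%:R^-1 * q%:R `^ s + (x j `^ (- s) - x j.+1 `^ (- s)).
  move=> /andP[j0 jq]; have xj0 : 0 < x j by rewrite divr_gt0// ltr0n.
  have xj1 : x j `^ (- s) <= q%:R `^ s.
    rewrite -xN1 ler_powR_nonpos ?oppr_le0 ?(ltW s0)// ?divr_gt0//.
    by rewrite ler_pM2r ?invr_gt0// ler_nat.
  rewrite /T GE// distrC.
  set e := (X in _ <= X).
  have := @Rintegral_near_cst _ f _ _ (f (x j.+1)) e (x_lt j)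
     (integrable_sub (x_ge0 j) (x_le1 _ jq)).
  rewrite xS => /(_ _) H.
  have {}H : `|Rintegral mu `]x j, x j.+1] f - f (x j.+1) * q%:R^-1| <= e * q%:R^-1.
    apply: H => t /andP[xt tx].
    apply: le_trans (cos_powR_dist xj0 xt tx) _.
    rewrite xS /e lerD2r ler_pM2l// mulr_gt0 ?invr_gt0// mulr_gt0//.
  have -> : q%:R * Rintegral mu `]x j, x j.+1] f - f (x j.+1) =
     q%:R * (Rintegral mu `]x j, x j.+1] f - f (x j.+1) * q%:R^-1).
    by rewrite mulrBr mulrCA divff ?mulr1// gt_eqF.
  rewrite normrM gtr0_norm//.
  apply: (@le_trans _ _ (q%:R * (e * q%:R^-1))); first by rewrite ler_pM2l.
  by rewrite mulrCA divff ?mulr1// gt_eqF.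
rewrite big_ltn//; apply: le_trans (ler_normD _ _) _.
have -> : (2 + 2 * pi + (1 - s)^-1) * q%:R `^ s =
  (1 + (1 - s)^-1) * q%:R `^ s + (1 + 2 * pi) * q%:R `^ s by ring.
apply: (lerD T0); apply: le_trans (ler_norm_sum _ _ _) _.
apply: (@le_trans _ _ (\sum_(1 <= j < q)
   (2 * pi * q%:R^-1 * q%:R `^ s + (x j `^ (- s) - x j.+1 `^ (- s))))).
  by rewrite ler_sum_nat.
rewrite big_split/= sumr_const_nat.
under eq_bigr do rewrite -opprB.
(* The power differences collapse to at most x_1^(-s) = q^s. The [q - 1] Lipschitz terms, each 2 pi
   q^(s-1), add up to at most 2 pi q^s. *)
rewrite sumrN (telescope_sumr (fun j => x j `^ (- s)))// opprB xN1.
rewrite [leRHS]mulrDl mul1r [leLHS]addrC; apply: lerD.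
  by rewrite gerBl powR_ge0.
rewrite (_ : _ *+ (q - 1) = 2 * pi * q%:R `^ s * (q%:R^-1 * (q - 1)%:R)); last first.
  by rewrite -[LHS]mulr_natr; ring.
apply: ler_piMr; first by rewrite !mulr_ge0 ?powR_ge0 ?ltW.
by rewrite ler_pdivrMl// mulr1 ler_nat leq_subr.
Qed.

End Riemann_sum.

(** * Convergence to zeta(2) and truncated sums of mu(d) / d^2 *)

Section zeta2.
Variable R : realType.

Let u (k : nat) : R := ((k.+1)%:R ^+ 2)^-1.

(** Telescoping of 1/(N+1)^2 <= 1/N - 1/(N+1). Because [u] is shifted, [series u N] is the sum of
    1/q^2 over 1 <= q <= N. *)
Lemma inv_square_tail_le m N : (0 < m <= N)%N ->
  series u N <= series u m + m%:R^-1 - N%:R^-1.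
Proof.
case/andP=> m0; elim: N => [|N IHN]; first by rewrite leqn0 => /eqP ->; rewrite addrK.
rewrite leq_eqVlt => /predU1P[<-|mN]; first by rewrite addrK.
rewrite seriesSr; apply: le_trans (lerD (IHN mN) (lexx _)) _.
have N0 : 0 < N%:R :> R by rewrite ltr0n (leq_trans m0).
rewrite -!addrA !lerD2l /u -natr1; set x := N%:R in N0 *.
have x1 : 0 < x + 1 by lra.
have -> : - x^-1 = - (x + 1)^-1 - (x * (x + 1))^-1.
  by field; rewrite !gt_eqF.
have : ((x + 1) ^+ 2)^-1 <= (x * (x + 1))^-1.
  by rewrite expr2 lef_pV2 ?posrE ?mulr_gt0// ler_pM2r//; lra.
lra.
Qed.

Lemma nondecreasing_inv_square_series : nondecreasing_seq (series u).
Proof.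
apply/nondecreasing_seqP => n; rewrite seriesSr lerDl invr_ge0.
by rewrite exprn_ge0.
Qed.

Lemma is_cvg_inv_square_series : cvgn (series u).
Proof.
apply: nondecreasing_is_cvgn; first exact: nondecreasing_inv_square_series.
exists (series u 1 + 1) => _ [N _ <-].
have [->|N0] := posnP N.
  rewrite /series/= big_geq// big_nat1 addr_ge0// invr_ge0 exprn_ge0//.
have /le_trans -> // := @inv_square_tail_le 1 N N0.
by rewrite invr1 gerDl oppr_le0 invr_ge0.
Qed.

Lemma zeta2_partial_sum m : (0 < m)%N ->
  `|\sum_(1 <= q < m.+1) ((q%:R : R) ^+ 2)^-1 - zeta2 R| <= m%:R^-1.
Proof.
move=> m0; rewrite (_ : \sum_(_ <= _ < _) _ = series u m); last by rewrite big_add1.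
have h1 : series u m <= zeta2 R.
  exact: nondecreasing_cvgn_le nondecreasing_inv_square_series is_cvg_inv_square_series m.
have h2 : zeta2 R <= series u m + m%:R^-1.
  apply: limr_le; first exact: is_cvg_inv_square_series.
  near=> N; apply: le_trans (inv_square_tail_le (_ : 0 < m <= N)%N) _.
    by rewrite m0/=; near: N; exact: nbhs_infty_ge.
  by rewrite gerBl invr_ge0.
rewrite ler_norml; apply/andP; split; lra.
Unshelve. all: by end_near. Qed.

Lemma zeta2_ge1 : 1 <= zeta2 R.
Proof.
have -> : 1 = series u 1 by rewrite /series/= big_nat1 /u expr1n invr1.
exact: nondecreasing_cvgn_le nondecreasing_inv_square_series is_cvg_inv_square_series 1%N.
Qed.

(** With k the integer part of n/d, one has n < (k+1) d <= 2 k d because k >= 1. *)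
Lemma divn_inv_le n d : (0 < d <= n)%N -> (n %/ d)%:R^-1 <= 2 * d%:R / n%:R :> R.
Proof.
case/andP=> d0 dn; have m0 : (0 < n %/ d)%N by rewrite divn_gt0.
have n0 := leq_trans d0 dn.
rewrite ler_pdivlMr ?ltr0n// mulrC ler_pdivrMr ?ltr0n// -!natrM ler_nat.
have := ltn_ceil n d0; nia.
Qed.

(** After multiplication by [zeta2 R], the number 1 is expanded by [sum_moebius_multiples] with h(l)
    = 1/l^2. What remains are tails of the zeta series, weighted by mu(d) / d^2. *)
Lemma moebius_zeta2 s n : 0 < s -> (0 < n)%N ->
  `|\sum_(1 <= d < n.+1) moebius R d * (d%:R ^+ 2)^-1 - (zeta2 R)^-1|
    <= 2 * (1 + s^-1) * n%:R `^ (s - 1).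
Proof.
move=> s0 n0; have z1 := zeta2_ge1; have n0' : 0 < n%:R :> R by rewrite ltr0n.
have z0 : 0 < zeta2 R by apply: lt_le_trans z1.
set M := \sum_(_ <= _ < _) _.
(* Dividing by [zeta2 R], which is at least 1, does not increase the error. *)
suff : `|M * zeta2 R - 1| <= 2 * (1 + s^-1) * n%:R `^ (s - 1).
  apply: le_trans; have -> : M - (zeta2 R)^-1 = (M * zeta2 R - 1) / zeta2 R.
    by rewrite mulrBl mulfK ?gt_eqF// mul1r.
  by rewrite normrM ler_piMr// normfV gtr0_norm// invf_le1.
rewrite -[X in _ - X](_ : ((1%:R : R) ^+ 2)^-1 = 1); last by rewrite expr1n invr1.
rewrite -(@sum_moebius_multiples R (fun l => ((l%:R : R) ^+ 2)^-1) n n0).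
rewrite /M mulr_suml -sumrB; apply: le_trans (ler_norm_sum _ _ _) _.
apply: (@le_trans _ _ (\sum_(1 <= d < n.+1)
   2 * n%:R `^ (s - 1) * d%:R `^ (- (1 + s)))); last first.
  rewrite -mulr_sumr -mulrA [leRHS]mulrAC -mulrA ler_pM2l// ler_pM2l ?powR_gt0//.
  exact: sum_powRN1_le.
rewrite !big_seq; apply: ler_sum => d; rewrite mem_index_iota ltnS => /andP[d0 dn].
have d0' : 0 < d%:R :> R by rewrite ltr0n.
have -> : \sum_(1 <= q < (n %/ d).+1) (((d * q)%:R : R) ^+ 2)^-1
    = (d%:R ^+ 2)^-1 * \sum_(1 <= q < (n %/ d).+1) (q%:R ^+ 2)^-1.
  by rewrite mulr_sumr; apply: eq_bigr => q _; rewrite natrM exprMn invfM.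
rewrite -mulrA -mulrBr -mulrBr !normrM distrC.
apply: (@le_trans _ _ (1 * ((d%:R ^+ 2)^-1 * (2 * d%:R / n%:R)))).
  apply: ler_pM => //; first exact: norm_moebius_le1.
  rewrite ger0_norm ?invr_ge0 ?exprn_ge0// ler_pM2l ?invr_gt0 ?exprn_gt0//.
  apply: le_trans (zeta2_partial_sum _) _; first by rewrite divn_gt0.
  by apply: divn_inv_le; rewrite d0.
rewrite mul1r (_ : _ * _ = 2 * n%:R^-1 * d%:R^-1); last first.
  by field; rewrite !gt_eqF.
rewrite -!mulrA ler_pM2l// -!powR_inv1//.
(* The factor (n/d)^s is at least 1. It replaces 1/d, whose sum would bring a logarithm, by
   d^(-1-s), whose sums are bounded. *)
apply: (@le_trans _ _ (n%:R `^ (- 1) * d%:R `^ (- 1) * ((n%:R / d%:R) `^ s))).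
  rewrite ler_pMr ?mulr_gt0 ?powR_gt0// -[leLHS](powRr0 (n%:R / d%:R)).
  by rewrite ler_powR ?(ltW s0)// ler_pdivlMr// mul1r ler_nat.
rewrite powRM ?invr_ge0// -[d%:R^-1]powR_inv1// -powRrM mulN1r opprD.
rewrite !powRD ?(gt_eqF n0') ?(gt_eqF d0') ?implybT// le_eqVlt; apply/orP; left; apply/eqP; ring.
Qed.

End zeta2.

(** * From lattice sums to the Farey sum *)

Section Farey.
Variables (R : realType) (s : R).
Hypothesis s01 : 0 < s < 1.

Let s0 : 0 < s. Proof. by case/andP: s01. Qed.
Let s1 : s < 1. Proof. by case/andP: s01. Qed.

Lemma cos_integralE : cos_integral s = Rintegral lebesgue_measure `[0, 1]%classic (cos_powR s).
Proof.
by rewrite /cos_integral; congr Rintegral; apply/funext => t; rewrite /cos_powR powRN.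
Qed.

(** The sum of cos(2 pi j/q) / (jq)^s over all pairs 1 <= j <= q <= m, coprime or not, because
    (jq)^(-s) = q^(-2s) (j/q)^(-s). *)
Let A m : R := \sum_(1 <= q < m.+1) q%:R `^ (- (2 * s)) *
  \sum_(1 <= j < q.+1) cos_powR s (j%:R / q%:R).

(** Scaling both [k] and [l] by [d] preserves k/l and multiplies (kl)^(-s) by d^(-2s). *)
Lemma Farey_cos_sum_moebius n :
  Farey_cos_sum n s = \sum_(1 <= d < n.+1)
    moebius R d * (d%:R `^ (- (2 * s)) * A (n %/ d)).
Proof.
rewrite /Farey_cos_sum
  (sum_coprime_pairs (fun k l => cos (2 * pi * (k%:R / l%:R)) / ((k * l)%:R `^ s))).
apply: eq_big_nat => d /andP[d0 _]; congr (_ * _).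
rewrite /A mulr_sumr; apply: eq_big_nat => q /andP[q0 _].
rewrite !mulr_sumr; apply: eq_big_nat => j /andP[j0 _].
have d0' : 0 < d%:R :> R by rewrite ltr0n.
have q0' : 0 < q%:R :> R by rewrite ltr0n.
have j0' : 0 < j%:R :> R by rewrite ltr0n.
have -> : (d * j)%:R / (d * q)%:R = j%:R / q%:R :> R.
  by rewrite !natrM; field; rewrite !gt_eqF.
rewrite -powRN /cos_powR; set z := cos _; rewrite !natrM !powRM ?invr_ge0 ?mulr_ge0//.
rewrite -[q%:R^-1]powR_inv1// -powRrM mulN1r opprK.
rewrite (_ : - (2 * s) = - s + - s); last by ring.
rewrite !powRD ?(gt_eqF d0') ?(gt_eqF q0') ?implybT//.
have qs : q%:R `^ (- s) * q%:R `^ s = 1.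
  by rewrite powRN mulVf// gt_eqF// powR_gt0.
transitivity (d%:R `^ (- s) * d%:R `^ (- s) * (q%:R `^ (- s) * (q%:R `^ (- s) * q%:R `^ s)
   * (z * j%:R `^ (- s)))); last by ring.
rewrite qs; ring.
Qed.

Let p := 2 * (1 - s).
Let I := cos_integral s.
Let c := I / p.

Let p0 : 0 < p. Proof. by rewrite mulr_gt0// subr_gt0. Qed.

(** In row [q] the main term is I q^(1-2s), where 1 - 2s = [p - 1], and the error is O(q^(-s)); both
    are then summed over [q]. *)
Lemma lattice_cos_sum_asymp : exists2 K, 0 <= K &
  forall m, (0 < m)%N -> `|A m - c * m%:R `^ p| <= K * m%:R `^ (1 - s).
Proof.
have s'0 : 0 < 1 - s by rewrite subr_gt0.
have ps : p - 1 <= 1 - s by rewrite /p; have := s0; lra.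
pose B := 2 + 2 * pi + (1 - s)^-1.
have B0 : 0 <= B by rewrite !addr_ge0 ?mulr_ge0 ?pi_ge0// invr_ge0 ltW.
(* The first term collects the Riemann sum errors through [sum_powRN_le]; the second comes from
   [sum_powR_asymp] with t = 1 - s. *)
exists (B / (1 - s) + `|I| * (2 + p^-1)).
  apply: addr_ge0; first by rewrite divr_ge0// ltW.
  by apply: mulr_ge0 => //; rewrite addr_ge0// invr_ge0 ltW.
move=> m m0.
have -> : A m - c * m%:R `^ p =
    \sum_(1 <= q < m.+1) q%:R `^ (- (2 * s)) *
      (\sum_(1 <= j < q.+1) cos_powR s (j%:R / q%:R) - q%:R * I)
    + I * (\sum_(1 <= q < m.+1) q%:R `^ (p - 1) - m%:R `^ p / p).
  rewrite mulrBr addrA mulr_sumr -big_split/=; congr (_ - _); last by rewrite /c; ring.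
  apply: eq_big_nat => q /andP[q0 _]; rewrite mulrBr.
  have q0' : 0 < q%:R :> R by rewrite ltr0n.
  rewrite (_ : p - 1 = - (2 * s) + 1); last by rewrite /p; ring.
  rewrite powRD ?(gt_eqF q0') ?implybT// powRr1//; ring.
rewrite [leRHS]mulrDl; apply: le_trans (ler_normD _ _) _; apply: lerD; last first.
  by rewrite normrM -mulrA ler_wpM2l// sum_powR_asymp// ltW.
apply: le_trans (ler_norm_sum _ _ _) _.
rewrite -mulrA [_^-1 * _]mulrC.
apply: (@le_trans _ _ (B * \sum_(1 <= q < m.+1) q%:R `^ (- s))); last first.
  by rewrite ler_wpM2l// sum_powRN_le.
rewrite mulr_sumr !big_seq; apply: ler_sum => q; rewrite mem_index_iota => /andP[q0 _].
have q0' : 0 < q%:R :> R by rewrite ltr0n.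
rewrite normrM ger0_norm ?powR_ge0// (_ : - s = - (2 * s) + s); last by ring.
rewrite powRD ?(gt_eqF q0') ?implybT// mulrCA ler_wpM2l ?powR_ge0//.
by rewrite /I cos_integralE cos_powR_Riemann_sum.
Qed.

Lemma Farey_cos_sum_asymp : exists2 K, 0 <= K & forall n, (0 < n)%N ->
  `|Farey_cos_sum n s - n%:R `^ p / (p * zeta2 R) * I| <= K * n%:R `^ (1 - s).
Proof.
have [K K0 AK] := lattice_cos_sum_asymp.
have s'0 : 0 < 1 - s by rewrite subr_gt0.
have ps : p - 1 <= 1 - s by rewrite /p; have := s0; lra.
have sV0 : 0 <= 1 + s^-1 by rewrite addr_ge0// invr_ge0 ltW.
(* [K] is the error of [A] at the integer part of n/d; [|c| * p] pays for replacing that integer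
   part by n/d in the main term. *)
pose L := K + `|c| * p.
have L0 : 0 <= L by rewrite addr_ge0// mulr_ge0// ltW.
(* The factor 1 + 1/s bounds the sum of d^(-1-s); the part 2|c| comes from [moebius_zeta2]. *)
exists ((L + 2 * `|c|) * (1 + s^-1)).
  by rewrite mulr_ge0// addr_ge0// mulr_ge0.
move=> n n0; have n0' : 0 < n%:R :> R by rewrite ltr0n.
have Adiv d : (0 < d <= n)%N ->
    `|A (n %/ d) - c * (n%:R / d%:R) `^ p| <= L * (n%:R / d%:R) `^ (1 - s).
  move=> /andP[d0 dn]; have m0 : (0 < n %/ d)%N by rewrite divn_gt0.
  rewrite -(subrK (c * (n %/ d)%:R `^ p) (A _)) -addrA -mulrBr [leRHS]mulrDl.
  apply: le_trans (ler_normD _ _) _; apply: lerD.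
    apply: le_trans (AK _ m0) _; rewrite ler_wpM2l// ge0_ler_powR ?nnegrE ?(ltW s'0)//.
    by rewrite ler_pdivlMr ?ltr0n// -natrM ler_nat leq_divM.
  rewrite normrM -mulrA ler_wpM2l// powR_divn_dist ?(ltW s'0)// d0//.
have -> : Farey_cos_sum n s - n%:R `^ p / (p * zeta2 R) * I =
  \sum_(1 <= d < n.+1) moebius R d * (d%:R `^ (- (2 * s)) *
     (A (n %/ d) - c * (n%:R / d%:R) `^ p))
  + c * n%:R `^ p * (\sum_(1 <= d < n.+1) moebius R d * (d%:R ^+ 2)^-1 - (zeta2 R)^-1).
  rewrite mulrBr addrA mulr_sumr -big_split/= Farey_cos_sum_moebius.
  congr (_ - _); last by rewrite invfM /c; ring.
  apply: eq_big_nat => d /andP[d0 _].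
  have d0' : 0 < d%:R :> R by rewrite ltr0n.
  have -> : d%:R `^ (- (2 * s)) * (A (n %/ d) - c * (n%:R / d%:R) `^ p)
     = d%:R `^ (- (2 * s)) * A (n %/ d) - c * n%:R `^ p * (d%:R ^+ 2)^-1.
    rewrite mulrBr powRM ?invr_ge0//; congr (_ - _).
    rewrite -[d%:R^-1]powR_inv1// -[(_ ^+ 2)^-1]powR_invn// -powRrM.
    (* Since 2s + p = 2, the product d^(-2s) (n/d)^p is n^p / d^2, with no [s] left in the exponent
       of d. *)
    rewrite (_ : - 2%:R = - (2 * s) + -1 * p); last by rewrite /p; ring.
    rewrite powRD ?(gt_eqF d0') ?implybT//; ring.
  ring.
apply: le_trans (ler_normD _ _) _; rewrite [(L + _) * _]mulrDl [leRHS]mulrDl; apply: lerD.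
  apply: le_trans (ler_norm_sum _ _ _) _.
  apply: (@le_trans _ _ (\sum_(1 <= d < n.+1)
      L * n%:R `^ (1 - s) * d%:R `^ (- (1 + s)))); last first.
    rewrite -mulr_sumr [leRHS]mulrAC ler_wpM2l ?mulr_ge0 ?powR_ge0//.
    exact: sum_powRN1_le.
  rewrite !big_seq; apply: ler_sum => d; rewrite mem_index_iota ltnS => /andP[d0 dn].
  have d0' : 0 < d%:R :> R by rewrite ltr0n.
  rewrite !normrM; apply: (@le_trans _ _ (1 * (d%:R `^ (- (2 * s)) *
     (L * (n%:R / d%:R) `^ (1 - s))))).
    apply: ler_pM; rewrite ?norm_moebius_le1 ?mulr_ge0// ger0_norm ?powR_ge0//.
    by rewrite ler_wpM2l ?powR_ge0// Adiv ?d0.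
  rewrite mul1r powRM ?invr_ge0// -[d%:R^-1]powR_inv1// -powRrM.
  rewrite (_ : - (1 + s) = - (2 * s) + - 1 * (1 - s)); last by ring.
  rewrite [d%:R `^ (_ + _)]powRD ?(gt_eqF d0') ?implybT// le_eqVlt; apply/orP; left; apply/eqP; ring.
rewrite normrM (normrM c) [`|n%:R `^ p|]ger0_norm ?powR_ge0//.
have -> : 2 * `|c| * (1 + s^-1) * n%:R `^ (1 - s)
    = `|c| * n%:R `^ p * (2 * (1 + s^-1) * n%:R `^ (s - 1)).
  rewrite (_ : 1 - s = p + (s - 1)); last by rewrite /p; ring.
  rewrite [_ `^ (p + _)]powRD ?(gt_eqF n0') ?implybT//; ring.
by rewrite ler_wpM2l ?mulr_ge0 ?powR_ge0// moebius_zeta2.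
Qed.

End Farey.

Theorem theorem2p8 (R : realType) (sigma : R) (hs0 : 0 < sigma) (hs1 : sigma < 1) :
  exists C : R, 0 < C /\
    forall n : nat, (1 <= n)%N ->
      `| Farey_cos_sum n sigma
         - (n%:R `^ (2 * (1 - sigma))) / (2 * (1 - sigma) * zeta2 R)
             * cos_integral sigma |
      <= C * n%:R `^ (1 - sigma).
Proof.
have s01 : 0 < sigma < 1 by rewrite hs0.
have [K K0 FK] := Farey_cos_sum_asymp s01.
(* [K] is only known to be nonnegative; adding 1 makes the constant positive. *)
exists (K + 1); split => [|n n0]; first by rewrite ltr_wpDl.
apply: le_trans (FK n n0) _.
by rewrite ler_wpM2r ?powR_ge0// lerDl.
Qed.
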